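(* Let $Y$ be a topological vector space, let $A$ be a closed proper subset of $Y$, let $k\in -0^+A\setminus\{0\}$, and let $D\subseteq Y$. Then $\varphi_{A,k}(a)\le 0$ for all $a\in A$ and $\varphi_{A,k}(a)<0$ for all $a\in\operatorname{core}A$. Moreover: (1) $A\cap D=\emptyset\iff\varphi_{A,k}(d)\not\le 0$ for all $d\in D$. (2) If $\varphi_{A,k}(d)\not<0$ for all $d\in D$, then $\operatorname{core}A\cap D=\emptyset$. (3) If $A-\mathbb{R}_{>}k\subseteq\operatorname{core}A$, then: $\operatorname{core}A\cap D=\emptyset\iff\varphi_{A,k}(d)\not<0$ for all $d\in D$.
   Context: Vector spaces are real; $\mathbb{R}_+=\{t\in\mathbb{R}\mid t\ge0\}$, $\mathbb{R}_{>}=\{t\in\mathbb{R}\mid t>0\}$. ''Proper subset of $Y$'' means nonempty and different from $Y$. $\operatorname{core}A$ is the algebraic interior of $A$. $0^+A=\{u\in Y\mid a+tu\in A\ \forall a\in A,\ \forall t\in\mathbb{R}_+\}$ is the recession cone. $\nu$ is a symbolic value not in $\overline{\mathbb{R}}=\mathbb{R}\cup\{\pm\infty\}$ and not comparable with any element of $\overline{\mathbb{R}}$ (so $\nu\not\le0$ and $\nu\not<0$ hold); $\inf\emptyset:=\nu$. The function $\varphi_{A,k}:Y\to\overline{\mathbb{R}}\cup\{\nu\}$ is defined by $\varphi_{A,k}(y)=\inf\{t\in\mathbb{R}\mid y\in tk+A\}$. *)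

(* Defs.v *)
From HB Require Import structures.
From mathcomp Require Import all_boot all_order all_algebra.
From mathcomp Require Import all_classical all_reals all_analysis.

Set Implicit Arguments.
Unset Strict Implicit.
Unset Printing Implicit Defensive.

Import Order.TTheory GRing.Theory Num.Theory.
Import numFieldNormedType.Exports.

Local Open Scope classical_set_scope.
Local Open Scope ring_scope.

(* Extended reals with an additional value [nu], incomparable with every
   extended real; [nu] is the infimum of the empty set. *)
Definition ereal_nu (R : realType) : Type := option (\bar R).

Definition nu {R : realType} : ereal_nu R := None.

Definition nu_le (R : realType) (x : ereal_nu R) (y : \bar R) : bool :=
  if x is Some r then (r <= y)%E else false.

Definition nu_lt (R : realType) (x : ereal_nu R) (y : \bar R) : bool :=
  if x is Some r then (r < y)%E else false.

(* The test for emptiness overrides the library convention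
   [ereal_inf set0 = +oo]. *)
Definition inf_nu (R : realType) (S : set R) : ereal_nu R :=
  if S == set0 then nu else Some (ereal_inf (EFin @` S)).

Definition phi (R : realType) (Y : lmodType R) (A : set Y) (k y : Y) :
    ereal_nu R :=
  inf_nu [set t : R | [set t *: k + a | a in A] y].

Definition recession_cone (R : realType) (Y : lmodType R) (A : set Y) :
    set Y :=
  [set u | forall a, A a -> forall t : R, 0 <= t -> A (a + t *: u)].

(* Algebraic interior; [s = 0] gives [core A `<=` A]. *)
Definition core (R : realType) (Y : lmodType R) (A : set Y) : set Y :=
  [set a | forall y : Y, exists2 t : R, 0 < t &
    forall s : R, 0 <= s <= t -> A (a + s *: y)].

(* Main.v *)
Require Import Defs.
From HB Require Import structures.
From mathcomp Require Import all_boot all_order all_algebra.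
From mathcomp Require Import all_classical all_reals all_analysis.

(** Put E(y) = {t | y - t k \in A}, so that phi A k y is the infimum of E(y),
    with the value nu when E(y) is empty.  An infimum is below c exactly when
    some member is, and nu is below nothing, so phi A k y < c iff
    y - t k \in A for some t < c ([phi_lt]).  When -k is a recession direction
    of A, the set E(y) is closed upwards, and when A is closed, so is E(y);
    hence an infimum at most c already forces c \in E(y), that is,
    phi A k y <= c iff y - c k \in A ([phi_le]).  At c = 0 this says that A is
    exactly the sublevel set {phi <= 0}, which is the first claim and (1).

    A point of the algebraic interior can be moved a little in the direction k
    without leaving A, which yields a negative member of E(a) ([core_phi_lt0]);
    so core A is contained in {phi < 0}, which is the second claim and (2).
    Conversely, phi A k d < 0 makes d a point of A - R_> k, so under the
    hypothesis of (3) the two sets coincide.  The disjointness equivalences are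
    these descriptions of A and core A read off on D ([setI_eq0_iff]). *)

Set Implicit Arguments.
Unset Strict Implicit.
Unset Printing Implicit Defensive.

Import Order.TTheory GRing.Theory Num.Theory.
Import numFieldNormedType.Exports.

Local Open Scope classical_set_scope.
Local Open Scope ring_scope.

Lemma setI_eq0_iff (T : Type) (A D : set T) (P : T -> Prop) :
  (forall d, A d <-> P d) -> (A `&` D = set0 <-> forall d, D d -> ~ P d).
Proof.
move=> AP; split=> [AD0 d Dd /AP Ad|DP].
  have : (A `&` D) d by [].
  by rewrite AD0.
by rewrite -subset0 => d [/AP Pd /DP].
Qed.

Lemma translate_mem (R : realType) (Y : lmodType R) (A : set Y) (k y : Y)
    (t : R) :
  [set t *: k + a | a in A] y <-> A (y - t *: k).
Proof.
split=> [[a Aa <-]|Ayt]; first by rewrite addrC addKr.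
by exists (y - t *: k) => //; rewrite addrC subrK.
Qed.

Lemma inf_nu_lt (R : realType) (S : set R) (c : R) :
  nu_lt (inf_nu S) c%:E <-> exists2 t, t < c & S t.
Proof.
rewrite /inf_nu; case: eqP => [-> /=|_ /=]; first by split=> // -[].
split=> [/ereal_inf_lt[_ [t St <-]]|[t tc St]].
  by rewrite lte_fin => tc; exists t.
apply: (@le_lt_trans _ _ t%:E); last by rewrite lte_fin.
by apply: ereal_inf_lbound; exists t.
Qed.

Lemma nu_le_lt (R : realType) (x : ereal_nu R) (c c' : R) :
  nu_le x c%:E -> c < c' -> nu_lt x c'%:E.
Proof. by case: x => [r /=|//] rc cc'; rewrite (le_lt_trans rc)// lte_fin. Qed.

Lemma inf_nu_le_mem (R : realType) (S : set R) (c : R) :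
  S c -> nu_le (inf_nu S) c%:E.
Proof.
move=> Sc; rewrite /inf_nu; case: eqP => [S0|_ /=].
  by move: Sc; rewrite S0.
by apply: ereal_inf_lbound; exists c.
Qed.

Lemma phi_lt (R : realType) (Y : lmodType R) (A : set Y) (k y : Y) (c : R) :
  nu_lt (phi A k y) c%:E <-> exists2 t, t < c & A (y - t *: k).
Proof.
rewrite inf_nu_lt; split=> -[t tc yt]; exists t => //; exact/translate_mem.
Qed.

Lemma cvg_subZ (R : realType) (Y : topologicalLmodType R) (k y : Y) (c : R) :
  y - t *: k @[t --> c^'+] --> y - c *: k.
Proof.
apply: cvg_at_right_filter.
have Zk : t *: k @[t --> c] --> c *: k.
  apply: (cvg_comp2 (f := id) (g := cst k) (h := fun (t : R^o) (v : Y) => t *: v)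
    cvg_id (cvg_cst k)).
  exact: (@scale_continuous R Y (c, k)).
apply: (cvg_comp2 (f := cst y) (h := fun u v : Y => u - v) (cvg_cst y) Zk).
exact: (@sub_continuous Y (y, c *: k)).
Qed.

(** If the infimum is at most c, then for every e > c some member of the set
    lies below e, and the recession direction -k carries it up to e.  Letting e
    decrease to c, closedness of A gives membership at c itself. *)
Lemma phi_le (R : realType) (Y : topologicalLmodType R) (A : set Y)
    (k y : Y) (c : R) :
  closed A -> recession_cone A (- k) ->
  nu_le (phi A k y) c%:E <-> A (y - c *: k).
Proof.
move=> A_closed Ak; split=> [yc|/translate_mem]; last exact: inf_nu_le_mem.
apply: (closed_cvg A A_closed) (cvg_subZ (k := k) (y := y) (c := c)).
near=> e.
have /phi_lt[t te Ayt] : nu_lt (phi A k y) e%:E by exact: nu_le_lt yc _.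
have -> : y - e *: k = y - t *: k + (e - t) *: - k.
  by rewrite scalerN -addrA -opprD -scalerDl [t + _]addrC subrK.
by apply: Ak; rewrite // subr_ge0 ltW.
Unshelve. all: by end_near. Qed.

Lemma core_phi_lt0 (R : realType) (Y : lmodType R) (A : set Y) (k a : Y) :
  core A a -> nu_lt (phi A k a) 0%E.
Proof.
move=> /(_ k)[t t0 At]; apply/phi_lt; exists (- t); first by rewrite oppr_lt0.
by rewrite scaleNr opprK; apply: At; rewrite lexx ltW.
Qed.

Theorem theorem2 (R : realType) (Y : topologicalLmodType R)
    (A : set Y) (k : Y) (D : set Y)
    (A_closed : closed A) (A_nonempty : A !=set0) (A_neqT : A <> setT)
    (hk : ([set - u | u in recession_cone A] `\ 0) k) :
  (forall a, A a -> nu_le (phi A k a) 0%E) /\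
  (forall a, core A a -> nu_lt (phi A k a) 0%E) /\
  (A `&` D = set0 <-> forall d, D d -> ~ nu_le (phi A k d) 0%E) /\
  ((forall d, D d -> ~ nu_lt (phi A k d) 0%E) -> core A `&` D = set0) /\
  ([set a - t *: k | a in A & t in [set t : R | 0 < t]] `<=` core A ->
   (core A `&` D = set0 <-> forall d, D d -> ~ nu_lt (phi A k d) 0%E)).
Proof.
have Ak : recession_cone A (- k) by case: hk => -[u Au <-] _; rewrite opprK.
have A_le0 d : A d <-> nu_le (phi A k d) 0%E.
  by have := phi_le d 0 A_closed Ak; rewrite scale0r subr0 => ->.
split=> [a /A_le0//|]; split=> [a|]; first exact: core_phi_lt0.
split; first exact: setI_eq0_iff.
split=> [D_ge0|A_sub_core].
  by rewrite -subset0 => d [/(core_phi_lt0 k) d_lt0 /D_ge0].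
apply: setI_eq0_iff => d; split; first exact: core_phi_lt0.
move=> /phi_lt[t t0 Adt]; apply: A_sub_core.
exists (d - t *: k) => //; exists (- t); first by rewrite /= oppr_gt0.
by rewrite scaleNr opprK subrK.
Qed.
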